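(* Every irreducible symmetric matrix $A\in\mathbb{R}^{n\times n}$ is strongly Schur-Horn continuous.
   Context: A symmetric matrix is irreducible if it cannot be brought to a block diagonal form with more than one block by a simultaneous permutation of rows and columns; equivalently, the undirected graph given by its nonzero off-diagonal pattern is connected. $\|\cdot\|_{\mathrm F}$ is the Frobenius norm; $\mathrm{diag}(M)$ is the vector of diagonal entries of a matrix $M$. Big-$O$ convention: $\varepsilon>0$ is the asymptotic variable tending to zero; perturbed quantities are families indexed by sufficiently small $\varepsilon>0$; all other data (matrix dimension, the matrix $A$) are constants. Definition (strong Schur-Horn continuity). Suppose $A\in\mathbb{R}^{n\times n}$ is a symmetric matrix with an eigendecomposition $A=Q\Lambda Q^\top$, where $Q$ is the orthonormal eigenvector matrix and $\Lambda$ is the diagonal eigenvalue matrix. $A$ is strongly Schur-Horn continuous if, for any perturbed eigenvalues $\widetilde\Lambda$ (a real diagonal matrix) satisfying $\mathrm{tr}(\widetilde\Lambda)=\mathrm{tr}(\Lambda)$ and $\|\widetilde\Lambda-\Lambda\|_{\mathrm F}=O(\varepsilon)$ for $\varepsilon>0$ sufficiently small, there exists a symmetric matrix $\widetilde B=G_2QG_1\widetilde\Lambda G_1^\top Q^\top G_2^\top$ such that (1) $\mathrm{diag}(\widetilde B)=\mathrm{diag}(A)$; (2) $G_1$ and $G_2$ are orthogonal matrices; (3) $\|G_i-I\|_{\mathrm F}=O(\varepsilon^{1/2})$ for $i=1,2$. *)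

(* Defs.v *)
From mathcomp Require Import all_boot all_order all_algebra all_fingroup.
From mathcomp Require Import all_classical all_reals all_analysis.

Set Implicit Arguments.
Unset Strict Implicit.
Unset Printing Implicit Defensive.

Import Order.TTheory GRing.Theory Num.Theory.
Import numFieldNormedType.Exports.

Local Open Scope classical_set_scope.
Local Open Scope ring_scope.

Definition symmetric_mx (R : realType) (n : nat) (A : 'M[R]_n) : Prop :=
  A^T = A.

Definition orthogonal_mx (R : realType) (n : nat) (Q : 'M[R]_n) : Prop :=
  Q^T *m Q = 1%:M /\ Q *m Q^T = 1%:M.

Definition diag_vec (R : realType) (n : nat) (A : 'M[R]_n) : 'rV[R]_n :=
  \row_i A i i.

(* Not the norm `|A| of the library, which is the maximum of the `|A i j|. *)
Definition frobenius_norm (R : realType) (n : nat) (A : 'M[R]_n) : R :=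
  Num.sqrt (\sum_i \sum_j A i j ^+ 2).

Definition block_diag_at (R : realType) (n : nat) (k : nat) (A : 'M[R]_n) :
    Prop :=
  forall i j : 'I_n, (i < k)%N != (j < k)%N -> A i j = 0.

(* Merging consecutive blocks turns a block diagonal form with more than one
   block into one with exactly two diagonal blocks, of sizes k and n - k;
   0 < k < n says that neither of them is empty. *)
Definition reducible_mx (R : realType) (n : nat) (A : 'M[R]_n) : Prop :=
  exists (s : 'S_n) (k : nat),
    (0 < k < n)%N /\ block_diag_at k (row_perm s (col_perm s A)).

Definition irreducible_mx (R : realType) (n : nat) (A : 'M[R]_n) : Prop :=
  ~ reducible_mx A.

Definition eigendecomposition (R : realType) (n : nat)
    (A Q : 'M[R]_n) (lambda : 'rV[R]_n) : Prop :=
  orthogonal_mx Q /\ A = Q *m diag_mx lambda *m Q^T.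

Definition bigO_at0 (R : realType) (f g : R -> R) : Prop :=
  (f : R -> R^o) =O_ (0^'+) (g : R -> R^o).

(* A family indexed by sufficiently small e > 0 is a total function of e : R
   constrained only near 0 on the right; the constants and thresholds hidden in
   the big-Os of the conclusion may depend on the family lambda'. *)
Definition strongly_schur_horn_continuous (R : realType) (n : nat)
    (A : 'M[R]_n) : Prop :=
  symmetric_mx A /\
  forall (Q : 'M[R]_n) (lambda : 'rV[R]_n), eigendecomposition A Q lambda ->
  forall lambda' : R -> 'rV[R]_n,
    (\forall e \near 0^'+, \tr (diag_mx (lambda' e)) = \tr (diag_mx lambda)) ->
    bigO_at0 (fun e => frobenius_norm (diag_mx (lambda' e) - diag_mx lambda))
             (fun e => e) ->
  exists B G1 G2 : R -> 'M[R]_n,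
    [/\ \forall e \near 0^'+,
          [/\ B e = G2 e *m Q *m G1 e *m diag_mx (lambda' e)
                      *m (G1 e)^T *m Q^T *m (G2 e)^T,
              symmetric_mx (B e),
              diag_vec (B e) = diag_vec A,
              orthogonal_mx (G1 e) & orthogonal_mx (G2 e)],
        bigO_at0 (fun e => frobenius_norm (G1 e - 1%:M)) (fun e => Num.sqrt e) &
        bigO_at0 (fun e => frobenius_norm (G2 e - 1%:M)) (fun e => Num.sqrt e)].

(* Main.v *)
(** Take [G1 = I]. Put [M = Q Lambda' Q^T], a symmetric perturbation of [A] of
    size O(e) with the trace of [A]. A rotation in the plane of two coordinates
    [v], [u] with [A v u <> 0] can set the [v]-th diagonal entry of [M] to its
    target [A v v] with an angle of size O(e), and changes no other diagonal
    entry than the [u]-th. The nonzero pattern of [A] is connected, so rotating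
    from the leaves of a spanning tree to the root repairs all diagonal entries
    but the last, and that one is then right because the trace is preserved.
    [G2] is the product of these rotations; it is even O(e)-close to [I]. *)

Require Import Defs.
From mathcomp Require Import all_boot all_order all_algebra.
From mathcomp Require Import all_fingroup.
From mathcomp Require Import all_classical all_reals all_analysis.
From mathcomp Require Import ring lra.

Set Implicit Arguments.
Unset Strict Implicit.
Unset Printing Implicit Defensive.

Import Order.TTheory GRing.Theory Num.Theory.
Import numFieldNormedType.Exports.

Local Open Scope ring_scope.

(** * The entrywise l1 norm and its comparison with the Frobenius norm *)

Section L1Norm.
Variable R : numDomainType.

(** Chosen because it is submultiplicative and invariant under transposition by elementary sums.
    Passing to and from the Frobenius norm costs factors that depend on the dimension alone, which a
    big-O absorbs. *)
Definition l1norm (m n : nat) (M : 'M[R]_(m, n)) : R :=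
  \sum_i \sum_j `|M i j|.

Lemma l1norm_ge0 m n (M : 'M[R]_(m, n)) : 0 <= l1norm M.
Proof. by apply: sumr_ge0 => i _; apply: sumr_ge0. Qed.

Lemma l1norm0 m n : l1norm (0 : 'M[R]_(m, n)) = 0.
Proof.
by rewrite /l1norm big1 // => i _; rewrite big1 // => j _; rewrite mxE normr0.
Qed.

Lemma ler_l1norm_entry m n (M : 'M[R]_(m, n)) i j : `|M i j| <= l1norm M.
Proof.
rewrite /l1norm (bigD1 i) //= (bigD1 j) //= -addrA lerDl addr_ge0 //.
  exact: sumr_ge0.
by apply: sumr_ge0 => k _; apply: sumr_ge0.
Qed.

Lemma ler_l1normD m n (M N : 'M[R]_(m, n)) :
  l1norm (M + N) <= l1norm M + l1norm N.
Proof.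
rewrite /l1norm -big_split ler_sum //= => i _.
by rewrite -big_split ler_sum //= => j _; rewrite mxE ler_normD.
Qed.

Lemma ler_l1normM m n p (M : 'M[R]_(m, n)) (N : 'M[R]_(n, p)) :
  l1norm (M *m N) <= l1norm M * l1norm N.
Proof.
rewrite /l1norm mulr_suml ler_sum // => i _.
have row_le j : `|(M *m N) i j| <= \sum_k `|M i k| * `|N k j|.
  rewrite mxE; apply: le_trans (ler_norm_sum _ _ _) _.
  by rewrite ler_sum // => k _; rewrite normrM.
apply: le_trans (ler_sum _ (fun j _ => row_le j)) _.
rewrite exchange_big mulr_suml ler_sum //= => k _.
rewrite -mulr_sumr ler_wpM2l // (bigD1 k) //= lerDl.
by apply: sumr_ge0 => l _; apply: sumr_ge0.
Qed.

Lemma l1norm_tr m n (M : 'M[R]_(m, n)) : l1norm M^T = l1norm M.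
Proof.
rewrite /l1norm exchange_big; apply: eq_bigr => i _.
by apply: eq_bigr => j _; rewrite mxE.
Qed.

Lemma ler_l1norm_const m n (M : 'M[R]_(m, n)) x :
  (forall i j, `|M i j| <= x) -> l1norm M <= (m * n)%:R * x.
Proof.
move=> Mx; apply: le_trans (ler_sum _ (fun i _ => ler_sum _ (fun j _ => Mx i j))) _.
by rewrite !sumr_const !card_ord -mulrnA mulr_natl mulnC.
Qed.

End L1Norm.

Lemma ler_frobenius_l1norm (R : realType) n (M : 'M[R]_n) :
  frobenius_norm M <= l1norm M.
Proof.
rewrite /frobenius_norm -(ger0_norm (l1norm_ge0 M)) -sqrtr_sqr ler_wsqrtr //.
rewrite expr2 {1}/l1norm mulr_suml ler_sum // => i _.
rewrite mulr_suml ler_sum // => j _.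
by rewrite -real_normK ?num_real // expr2 ler_wpM2l // ler_l1norm_entry.
Qed.

Lemma ler_entry_frobenius (R : realType) n (M : 'M[R]_n) i j :
  `|M i j| <= frobenius_norm M.
Proof.
rewrite -sqrtr_sqr ler_wsqrtr // (bigD1 i) //= (bigD1 j) //= -addrA lerDl.
rewrite addr_ge0 //; first by apply: sumr_ge0 => k _; rewrite sqr_ge0.
by apply: sumr_ge0 => k _; apply: sumr_ge0 => l _; rewrite sqr_ge0.
Qed.

(** * Orthogonal matrices and orthogonal conjugation *)

Section Orthogonal.
Variables (R : realType) (n : nat).
Implicit Types G H M : 'M[R]_n.

Lemma orthogonal_mx1 : orthogonal_mx (1%:M : 'M[R]_n).
Proof. by rewrite /orthogonal_mx trmx1 mulmx1. Qed.

Lemma orthogonal_mxM G H :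
  orthogonal_mx G -> orthogonal_mx H -> orthogonal_mx (G *m H).
Proof.
move=> [GtG GGt] [HtH HHt]; rewrite /orthogonal_mx trmx_mul; split.
  by rewrite mulmxA -(mulmxA H^T) GtG mulmx1.
by rewrite mulmxA -(mulmxA G) HHt mulmx1.
Qed.

Lemma mxtrace_orthogonal_conj G M :
  orthogonal_mx G -> \tr (G *m M *m G^T) = \tr M.
Proof. by case=> GtG _; rewrite mxtrace_mulC mulmxA GtG mul1mx. Qed.

Lemma trmx_conj G M : (G *m M *m G^T)^T = G *m M^T *m G^T.
Proof. by rewrite !trmx_mul trmxK mulmxA. Qed.

End Orthogonal.

(** * Plane rotations that set one diagonal entry *)

(* The tangent [tau] of the angle is the small root of the quadratic equation
   [(d - t) tau^2 + 2 b tau + (a - t) = 0]. *)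
Lemma plane_rotation_entry (R : realType) (a b d t : R) :
  b != 0 -> (d - t) * (a - t) <= b ^+ 2 ->
  exists c s : R,
    [/\ c ^+ 2 + s ^+ 2 = 1, c ^+ 2 * a + 2 * (c * s) * b + s ^+ 2 * d = t,
        `|c - 1| <= `|a - t| / `|b| & `|s| <= `|a - t| / `|b|].
Proof.
move=> b0 discr_ge0.
have b2_gt0 : 0 < b ^+ 2 by rewrite exprn_even_gt0.
(* The discriminant of the quadratic is [4 b^2 r^2]. *)
pose r := Num.sqrt (1 - (d - t) * (a - t) / b ^+ 2).
have r_ge0 : 0 <= r by exact: sqrtr_ge0.
have r2 : r ^+ 2 = 1 - (d - t) * (a - t) / b ^+ 2.
  by rewrite sqr_sqrtr // subr_ge0 ler_pdivrMr // mul1r.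
have r1_gt0 : 0 < 1 + r by lra.
(* The rationalized form of the root makes sense even when [d = t], and [1 + r >= 1] bounds it by
   [|a - t| / |b|]. *)
pose tau := - (a - t) / (b * (1 + r)).
have quad : (d - t) * tau ^+ 2 + 2 * b * tau + (a - t) = 0.
  have r1_neq0 : 1 + r != 0 by rewrite gt_eqF.
  have pq : (d - t) * (a - t) = b ^+ 2 * (1 - r ^+ 2).
    by rewrite r2; field.
  have -> : (d - t) * tau ^+ 2 =
      ((d - t) * (a - t)) * (a - t) / (b ^+ 2 * (1 + r) ^+ 2).
    by rewrite /tau; field; rewrite r1_neq0 b0.
  by rewrite pq /tau; field; rewrite r1_neq0 b0.
have tau_le : `|tau| <= `|a - t| / `|b|.
  rewrite /tau normrM normrN normfV normrM invfM mulrA ler_piMr ?divr_ge0 //.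
  by rewrite gtr0_norm // invf_le1 // lerDl.
have t2_gt0 : 0 < 1 + tau ^+ 2 by rewrite ltr_pwDl // sqr_ge0.
pose c := (Num.sqrt (1 + tau ^+ 2))^-1.
have c2 : c ^+ 2 = (1 + tau ^+ 2)^-1 by rewrite /c exprVn sqr_sqrtr // ltW.
have c_ge0 : 0 <= c by rewrite invr_ge0 sqrtr_ge0.
have cs1 : c ^+ 2 + (tau * c) ^+ 2 = 1.
  by rewrite exprMn c2; field; rewrite gt_eqF.
have c_le1 : c <= 1.
  by rewrite -(@expr_le1 _ 2) // -cs1 lerDl sqr_ge0.
have s_le : `|tau * c| <= `|tau|.
  by rewrite normrM (ger0_norm c_ge0) ler_piMr.
exists c, (tau * c); split => //.
- apply/eqP; rewrite -subr_eq0.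
  have -> : c ^+ 2 * a + 2 * (c * (tau * c)) * b + (tau * c) ^+ 2 * d - t =
    c ^+ 2 * ((d - t) * tau ^+ 2 + 2 * b * tau + (a - t))
      + t * (c ^+ 2 + (tau * c) ^+ 2 - 1) by ring.
  by rewrite quad cs1; apply/eqP; ring.
(* With [s = tau c] and [0 <= c <= 1]: [1 - c <= 1 - c^2 = s^2 <= |s|]. *)
- apply: le_trans _ tau_le; apply: le_trans _ s_le.
  rewrite distrC ger0_norm ?subr_ge0 //.
  have s_le1 : `|tau * c| <= 1.
    by rewrite -(@expr_le1 _ 2) // real_normK ?num_real // -cs1 lerDr sqr_ge0.
  apply: (@le_trans _ _ (`|tau * c| ^+ 2)); last first.
    by rewrite expr2 ler_piMr.
  by rewrite real_normK ?num_real //; nra.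
- exact: le_trans s_le tau_le.
Qed.

Section PlaneRotation.
Variables (R : realType) (n : nat) (v u : 'I_n) (c s : R).
Hypotheses (v_neq_u : v != u) (cs1 : c ^+ 2 + s ^+ 2 = 1).

(** Rows are combinations of indicators, so that a sum against a row collapses to at most two
    terms. *)
Definition plane_rotation : 'M[R]_n := \matrix_(i, j)
  if i == v then c * (j == v)%:R + s * (j == u)%:R
  else if i == u then - s * (j == v)%:R + c * (j == u)%:R
  else (j == i)%:R.

Let sum_delta (f : 'I_n -> R) i : \sum_k (k == i)%:R * f k = f i.
Proof.
rewrite (bigD1 i) //= eqxx mul1r big1 ?addr0 // => k /negbTE ->.
by rewrite mul0r.
Qed.

Let sum_delta2 (f : 'I_n -> R) x y :
  \sum_k (x * (k == v)%:R + y * (k == u)%:R) * f k = x * f v + y * f u.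
Proof.
rewrite -[f v]sum_delta -[f u]sum_delta !mulr_sumr -big_split /=.
by apply: eq_bigr => k _; rewrite mulrDl !mulrA.
Qed.

Lemma plane_rotation_orthogonal : orthogonal_mx plane_rotation.
Proof.
suff GGt : plane_rotation *m plane_rotation^T = 1%:M.
  by split => //; apply: mulmx1C.
have u_neq_v : (u == v) = false by rewrite eq_sym (negbTE v_neq_u).
apply/matrixP => i j; rewrite !mxE.
under eq_bigr => k _ do rewrite !mxE.
have diag_eq : c * c + s * s = 1 by rewrite -!expr2.
have [->|iv] := eqVneq i v.
  rewrite sum_delta2 !eqxx (negbTE v_neq_u) u_neq_v.
  have [_|jv] := eqVneq j v => /=.
    by rewrite !mulr1 !mulr0 addr0 add0r.
  by have [_|_] := eqVneq j u => /=; ring.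
have [->|iu] := eqVneq i u.
  rewrite sum_delta2 !eqxx (negbTE v_neq_u) u_neq_v.
  have [->|_] := eqVneq j v => /=; first by rewrite u_neq_v /=; ring.
  have [_|_] := eqVneq j u => /=; last by ring.
  by rewrite !mulr1 !mulr0 addr0 add0r mulrNN addrC.
rewrite sum_delta (negbTE iv) (negbTE iu).
have [->|_] := eqVneq j v; first by rewrite (negbTE iv) !mulr0 addr0.
by have [->|] := eqVneq j u; rewrite ?(negbTE iu) ?mulr0 ?addr0.
Qed.

Let conj_entry (M : 'M[R]_n) i :
  (plane_rotation *m M *m plane_rotation^T) i i =
  \sum_l plane_rotation i l * \sum_k plane_rotation i k * M k l.
Proof.
by rewrite mxE; apply: eq_bigr => l _; rewrite mulrC !mxE.
Qed.

Lemma plane_rotation_conj_pivot (M : 'M[R]_n) : M^T = M ->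
  (plane_rotation *m M *m plane_rotation^T) v v =
  c ^+ 2 * M v v + 2 * (c * s) * M v u + s ^+ 2 * M u u.
Proof.
move=> Msym; have Muv : M u v = M v u by rewrite -{1}Msym mxE.
have row_v (f : 'I_n -> R) :
    \sum_k plane_rotation v k * f k = c * f v + s * f u.
  by under eq_bigr => k _ do rewrite mxE eqxx; rewrite sum_delta2.
by rewrite conj_entry !row_v Muv; ring.
Qed.

Lemma plane_rotation_conj_fixed (M : 'M[R]_n) i : i != v -> i != u ->
  (plane_rotation *m M *m plane_rotation^T) i i = M i i.
Proof.
move=> /negbTE iv /negbTE iu.
have row_i (f : 'I_n -> R) : \sum_k plane_rotation i k * f k = f i.
  by under eq_bigr => k _ do rewrite mxE iv iu; rewrite sum_delta.
by rewrite conj_entry !row_i.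
Qed.

Lemma plane_rotation_sub1 x : `|c - 1| <= x -> `|s| <= x ->
  l1norm (plane_rotation - 1%:M) <= (n * n)%:R * x.
Proof.
move=> cx sx; have x_ge0 : 0 <= x by exact: le_trans sx.
have u_neq_v : (u == v) = false by rewrite eq_sym (negbTE v_neq_u).
apply: ler_l1norm_const => i j; rewrite !mxE.
have [->|iv] := eqVneq i v.
  have [->|_] := eqVneq j v => /=.
    by rewrite (negbTE v_neq_u) mulr0 addr0 mulr1.
  rewrite mulr0 add0r subr0.
  by case: eqP => _; rewrite ?mulr1 ?mulr0 ?normr0.
have [->|iu] := eqVneq i u.
  have [->|_] := eqVneq j u => /=.
    by rewrite u_neq_v mulr0 add0r mulr1.
  rewrite mulr0 addr0 subr0.
  by case: eqP => _; rewrite ?mulr1 ?mulr0 ?normr0 // normrN.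
by rewrite eq_sym subrr normr0.
Qed.

End PlaneRotation.

(** For [M] near [A] the pivot [M v u] stays away from 0 while [M v v - A v v] is small, so the
    quadratic for the angle has a real root of the order of the error. The constants depend on [A],
    [v], [u] and not on [M]. *)
Lemma fix_diag_entry (R : realType) n (A : 'M[R]_n) (v u : 'I_n) :
  v != u -> A v u != 0 ->
  exists L delta : R, [/\ 0 <= L, 0 < delta &
    forall M : 'M[R]_n, M^T = M -> l1norm (M - A) <= delta ->
    exists G : 'M[R]_n, [/\ orthogonal_mx G,
      l1norm (G - 1%:M) <= L * l1norm (M - A),
      (G *m M *m G^T) v v = A v v &
      forall i, i != v -> i != u -> (G *m M *m G^T) i i = M i i]].
Proof.
move=> vu Avu0; set be := `|A v u|.
have be_gt0 : 0 < be by rewrite normr_gt0.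
pose D := `|A u u - A v v| + 1.
have D_gt0 : 0 < D by rewrite ltr_wpDl.
(* In the radius, [1] gives [|M u u - A v v| <= D], [be / 2] gives [|M v u| >= be / 2], and
   [be ^+ 2 / (4 * D)] then makes the discriminant nonnegative. *)
exists ((n * n)%:R * (2 / be)), (Num.min (Num.min 1 (be / 2)) (be ^+ 2 / (4 * D))).
split.
- by rewrite mulr_ge0 ?divr_ge0 // ltW.
- by rewrite !lt_min ltr01 !divr_gt0 ?exprn_gt0 ?mulr_gt0.
move=> M Msym; set x := l1norm _; rewrite !le_min => /andP[/andP[x_le1 x_be] x_D].
have x_ge0 : 0 <= x by exact: l1norm_ge0.
have close i j : `|M i j - A i j| <= x.
  by have := ler_l1norm_entry (M - A) i j; rewrite !mxE.
have b_ge : be / 2 <= `|M v u|.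
  have := lerB_dist (A v u) (M v u); have := close v u.
  rewrite distrC -/be; lra.
have b_gt0 : 0 < `|M v u| by apply: lt_le_trans b_ge; rewrite divr_gt0.
have d_le : `|M u u - A v v| <= D.
  have -> : M u u - A v v = (A u u - A v v) + (M u u - A u u) by ring.
  apply: le_trans (ler_normD _ _) _; rewrite lerD2l.
  exact: le_trans (close u u) x_le1.
have discr : (M u u - A v v) * (M v v - A v v) <= M v u ^+ 2.
  apply: le_trans (ler_norm _) _; rewrite normrM.
  apply: (@le_trans _ _ (D * x)); first by rewrite ler_pM.
  apply: (@le_trans _ _ ((be / 2) ^+ 2)).
    move: x_D; rewrite ler_pdivlMr ?mulr_gt0 //.
    have -> : (be / 2) ^+ 2 = be ^+ 2 / 4 by field.
    by rewrite ler_pdivlMr //; lra.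
  rewrite -[leRHS]real_normK ?num_real // lerXn2r // nnegrE ?divr_ge0 //.
  exact: ltW.
have b0 : M v u != 0 by rewrite -normr_gt0.
have [c [s [cs1 pivot c_le s_le]]] := plane_rotation_entry b0 discr.
have tan_le : `|M v v - A v v| / `|M v u| <= 2 / be * x.
  rewrite ler_pdivrMr //.
  apply: le_trans (close v v) _.
  rewrite mulrAC ler_peMl // mulrAC ler_pdivlMr // mul1r; lra.
exists (plane_rotation v u c s); split.
- exact: plane_rotation_orthogonal.
- rewrite -mulrA; apply: plane_rotation_sub1 => //.
    exact: le_trans c_le tan_le.
  exact: le_trans s_le tan_le.
- by rewrite plane_rotation_conj_pivot.
- by move=> i iv iu; rewrite plane_rotation_conj_fixed.
Qed.

(** * Induction on the set of diagonal entries allowed to be wrong *)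

(** The induction invariant: [S] holds the coordinates not yet corrected, and [K] and [delta] are
    uniform in [M]. *)
Definition diag_repairable (R : realType) n (A : 'M[R]_n) (S : {set 'I_n}) :=
  exists K delta : R, [/\ 0 <= K, 0 < delta &
    forall M : 'M[R]_n, M^T = M -> \tr M = \tr A ->
      (forall i, i \notin S -> M i i = A i i) -> l1norm (M - A) <= delta ->
    exists G : 'M[R]_n, [/\ orthogonal_mx G,
      l1norm (G - 1%:M) <= K * l1norm (M - A) &
      diag_vec (G *m M *m G^T) = diag_vec A]].

(** Equality of traces forces the single free entry, so the identity is already a repair. *)
Lemma diag_repairable_set1 (R : realType) n (A : 'M[R]_n) (r : 'I_n) :
  diag_repairable A [set r].
Proof.
exists 0, 1; split => // M Msym trM diagM _; exists 1%:M; split.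
- exact: orthogonal_mx1.
- by rewrite subrr mul0r l1norm0.
rewrite trmx1 mulmx1 mul1mx; apply/rowP => i; rewrite !mxE.
have off_r j : j != r -> M j j = A j j by move=> jr; rewrite diagM // inE.
have [->|/off_r //] := eqVneq i r.
move: trM; rewrite /mxtrace (bigD1 r) //= [RHS](bigD1 r) //=.
by rewrite (eq_bigr _ off_r) => /addIr.
Qed.

(** A rotation in the plane of [v] and [u] corrects entry [v] and moves its error to entry [u],
    which lies in [S]; the repair for [S] then finishes. *)
Lemma diag_repairable_setU1 (R : realType) n (A : 'M[R]_n) (S : {set 'I_n})
    (v u : 'I_n) :
  v \notin S -> u \in S -> A v u != 0 ->
  diag_repairable A S -> diag_repairable A (v |: S).
Proof.
move=> vS uS Avu [K [d0 [K_ge0 d0_gt0 repairS]]].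
have vu : v != u by apply: contraNneq vS => ->.
have [L [d1 [L_ge0 d1_gt0 rotate]]] := fix_diag_entry vu Avu.
pose a := l1norm A; have a_ge0 : 0 <= a by exact: l1norm_ge0.
(* [g] bounds [l1norm G], and [L'] collects the bounds on the three terms into which [N - A] is
   split below, each linear in the error [x]. *)
pose g := l1norm (1%:M : 'M[R]_n) + L * d1.
have g_ge0 : 0 <= g by rewrite addr_ge0 ?l1norm_ge0 // mulr_ge0 // ltW.
pose L' := g * g + L * a * g + a * L.
have L'_ge0 : 0 <= L' by rewrite !addr_ge0 // !mulr_ge0.
(* The constant comes from [H G - 1 = (H - 1) G + (G - 1)]. The radius ensures [L' x <= d0], so that
   the repair for [S] applies to [N]; the [+ 1] keeps the denominator positive. *)
exists (K * L' * g + L), (Num.min d1 (d0 / (L' + 1))); split.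
- by rewrite addr_ge0 // !mulr_ge0.
- by rewrite lt_min d1_gt0 divr_gt0 // ltr_wpDl.
move=> M Msym trM diagM; set x := l1norm _; rewrite le_min => /andP[x_d1 x_d0].
have x_ge0 : 0 <= x by exact: l1norm_ge0.
have [G [Gorth G_le pivot fixed]] := rotate M Msym x_d1.
rewrite -/x in G_le.
have g_le : l1norm G <= g.
  rewrite -[G](subrK 1%:M) addrC; apply: le_trans (ler_l1normD _ _) _.
  by rewrite lerD2l; apply: le_trans G_le _; rewrite ler_wpM2l.
pose N := G *m M *m G^T.
have N_le : l1norm (N - A) <= L' * x.
  have -> : N - A = G *m (M - A) *m G^T + (G - 1%:M) *m A *m G^T
                    + A *m (G - 1%:M)^T.
    rewrite /N [(G - _)^T]linearB /= trmx1 !(mulmxBr, mulmxBl) mul1mx mulmx1.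
    by rewrite !addrA !subrK.
  have -> : L' * x = g * x * g + L * x * a * g + a * (L * x).
    by rewrite /L'; ring.
  apply: le_trans (ler_l1normD _ _) (lerD _ _).
    apply: le_trans (ler_l1normD _ _) (lerD _ _).
      apply: le_trans (ler_l1normM _ _) _; rewrite l1norm_tr.
      rewrite ler_pM ?l1norm_ge0 //; apply: le_trans (ler_l1normM _ _) _.
      by rewrite ler_pM ?l1norm_ge0.
    apply: le_trans (ler_l1normM _ _) _; rewrite l1norm_tr.
    rewrite ler_pM ?l1norm_ge0 //; apply: le_trans (ler_l1normM _ _) _.
    by rewrite ler_pM ?l1norm_ge0.
  apply: le_trans (ler_l1normM _ _) _; rewrite l1norm_tr.
  by rewrite ler_pM ?l1norm_ge0.
have Nsym : N^T = N by rewrite trmx_conj Msym.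
have trN : \tr N = \tr A by rewrite mxtrace_orthogonal_conj.
have diagN i : i \notin S -> N i i = A i i.
  have [-> //|iv iS] := eqVneq i v.
  rewrite fixed //; first by rewrite diagM // !inE negb_or iv.
  by apply: contraNneq iS => ->.
have N_d0 : l1norm (N - A) <= d0.
  apply: le_trans N_le _; move: x_d0; rewrite ler_pdivlMr ?ltr_wpDl //.
  by apply: le_trans; rewrite mulrC ler_wpM2l // lerDl.
have [H [Horth H_le diagH]] := repairS N Nsym trN diagN N_d0.
exists (H *m G); split.
- exact: orthogonal_mxM.
- have -> : H *m G - 1%:M = (H - 1%:M) *m G + (G - 1%:M).
    by rewrite mulmxBl mul1mx addrA subrK.
  rewrite mulrDl; apply: le_trans (ler_l1normD _ _) (lerD _ G_le).
  apply: le_trans (ler_l1normM _ _) _.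
  rewrite mulrAC ler_pM ?l1norm_ge0 // -mulrA.
  by apply: le_trans H_le _; rewrite ler_wpM2l.
- by rewrite -diagH /N trmx_mul !mulmxA.
Qed.

(** * Irreducibility as connectedness *)

(** The permutation lists [S] first and its complement after it, which gives a first block of size
    [#|S|]; symmetry of [A] kills the other off-diagonal block. *)
Lemma reducible_mx_set (R : realType) n (A : 'M[R]_n) (S : {set 'I_n}) :
  A^T = A -> S != finset.set0 -> S != [set: 'I_n]%SET ->
  (forall v u, v \notin S -> u \in S -> A v u = 0) -> reducible_mx A.
Proof.
move=> Asym S0 ST cut.
pose e := enum S ++ enum (~: S)%SET.
have e_size : size e = n.
  by rewrite size_cat -!cardE cardsC card_ord.
have e_uniq : uniq e.
  rewrite cat_uniq !enum_uniq andbT /=; apply/hasPn => i.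
  by rewrite !mem_enum inE.
have S_gt0 : (0 < #|S|)%N by rewrite card_gt0.
(* The default [i] is never reached, since [e] has size [n]. *)
have s_inj : injective (fun i : 'I_n => nth i e i).
  move=> i j; rewrite (set_nth_default i) ?e_size // => /eqP.
  by rewrite nth_uniq ?e_size // => /eqP/val_inj.
have sS (i : 'I_n) : (perm s_inj i \in S) = (i < #|S|)%N.
  rewrite permE nth_cat -cardE; case: ltnP => iS.
    by rewrite -mem_enum mem_nth // -cardE.
  have : nth i (enum (~: S)%SET) (i - #|S|) \in enum (~: S)%SET.
    by rewrite mem_nth // -cardE -(ltn_add2l #|S|) subnKC // cardsC card_ord.
  by rewrite mem_enum inE => /negbTE.
exists (perm s_inj), #|S|; split.
  have : S \proper [set: 'I_n]%SET by rewrite finset.properEneq ST finset.subsetT.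
  by move/proper_card; rewrite S_gt0 cardsT card_ord.
move=> i j; rewrite !mxE -!sS.
case: (boolP (perm s_inj i \in S)) => iS; case: (boolP (perm s_inj j \in S)) => jS // _.
  by rewrite -Asym mxE cut.
by rewrite cut.
Qed.

(** The set grows from one vertex: while it is proper, irreducibility provides an edge [A v u != 0]
    that leaves it. Vertices added last are rotated first. Dimension 0 has no starting vertex and is
    treated apart. *)
Lemma irreducible_diag_repairable (R : realType) n (A : 'M[R]_n) :
  A^T = A -> irreducible_mx A -> diag_repairable A [set: 'I_n]%SET.
Proof.
move=> Asym Airr; have [n0|n_gt0] := posnP n.
  exists 0, 1; split => // M _ _ _ _; exists 1%:M; split.
  - exact: orthogonal_mx1.
  - by rewrite subrr mul0r l1norm0.
  - by apply/rowP => i; have := ltn_ord i; rewrite {2}n0.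
suff grow m : (m < n)%N ->
    exists S : {set 'I_n}, #|S| = m.+1 /\ diag_repairable A S.
  have [S [cardS repS]] := grow n.-1 ltac:(by rewrite prednK).
  suff <- : S = [set: 'I_n]%SET by [].
  by apply/eqP; rewrite eqEcard finset.subsetT cardsT card_ord cardS prednK // leqnn.
elim: m => [_|m IHm mn].
  exists [set Ordinal n_gt0]%SET; rewrite cards1; split => //.
  exact: diag_repairable_set1.
have [S [cardS repS]] := IHm (ltnW mn).
have [v [u [vS uS Avu]]] : exists v u, [/\ v \notin S, u \in S & A v u != 0].
  apply: contrapT => noedge; apply: Airr; apply: (@reducible_mx_set _ _ _ S) => //.
  - by rewrite -card_gt0 cardS.
  - by apply: contraTneq mn => ST; rewrite -cardS ST cardsT card_ord ltnn.
  - move=> v u vS uS; apply/eqP/negPn/negP => Avu; apply: noedge.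
    by exists v, u.
exists (v |: S)%SET; rewrite cardsU1 vS cardS; split => //.
exact: diag_repairable_setU1 vS uS Avu repS.
Qed.

(** * From a single perturbed matrix to families indexed by [e] *)

Local Open Scope classical_set_scope.

Theorem lemma3p6 (R : realType) (n : nat) (A : 'M[R]_n) :
  symmetric_mx A -> irreducible_mx A -> strongly_schur_horn_continuous A.
Proof.
move=> Asym Airr; split=> // Q la [Qorth AQ] la' tr_la' /eqO_exP[C C_gt0 la'_le].
have [K [d [K_ge0 d_gt0 repair]]] := irreducible_diag_repairable Asym Airr.
pose M e := Q *m diag_mx (la' e) *m Q^T.
pose P e G := [/\ orthogonal_mx G, l1norm (G - 1%:M) <= K * l1norm (M e - A) &
  diag_vec (G *m M e *m G^T) = diag_vec A].
(* A repair is chosen for each [e]; the default [1%:M] covers those [e] for which none exists, and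
   [GP] excludes them near 0. *)
pose G e := xget 1%:M (P e).
(* Each entry of the eigenvalue perturbation is at most [C e], and there are [n * n] of them;
   conjugation by [Q] costs two factors [l1norm Q]. *)
pose D := l1norm Q * (n * n)%:R * l1norm Q * C.
have D_ge0 : 0 <= D by rewrite !mulr_ge0 ?l1norm_ge0 // ltW.
have M_le : \forall e \near 0^'+, l1norm (M e - A) <= D * e.
  near=> e.
  have e_gt0 : 0 < e by near: e; exact: nbhs_right_gt.
  have -> : M e - A = Q *m (diag_mx (la' e) - diag_mx la) *m Q^T.
    by rewrite {1}AQ mulmxBr mulmxBl.
  apply: le_trans (ler_l1normM _ _) _; rewrite l1norm_tr.
  have -> : D * e = l1norm Q * ((n * n)%:R * (C * e)) * l1norm Q.
    by rewrite /D; ring.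
  rewrite ler_wpM2r ?l1norm_ge0 //; apply: le_trans (ler_l1normM _ _) _.
  rewrite ler_wpM2l ?l1norm_ge0 //; apply: ler_l1norm_const => i j.
  apply: le_trans (ler_entry_frobenius _ i j) _; apply: le_trans (ler_norm _) _.
  rewrite -[X in _ * X](gtr0_norm e_gt0).
  by near: e.
have GP : \forall e \near 0^'+, P e (G e).
  near=> e; rewrite /G; suff [H PH] : exists H, P e H by exact: xgetI PH.
  have Me_le : l1norm (M e - A) <= D * e by near: e.
  apply: repair => //.
  - by rewrite trmx_conj tr_diag_mx.
  - rewrite mxtrace_orthogonal_conj // AQ mxtrace_orthogonal_conj //.
    by near: e.
  - by move=> i; rewrite inE.
  - apply: le_trans Me_le _.
    (* [D] may vanish, so the threshold on [e] is [d / (D + 1)]. *)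
    apply: (@le_trans _ _ ((D + 1) * e)).
      by rewrite ler_wpM2r ?lerDl.
    rewrite mulrC -ler_pdivlMr ?ltr_wpDl //; near: e.
    by apply: nbhs_right_le; rewrite divr_gt0 // ltr_wpDl.
exists (fun e => G e *m M e *m (G e)^T), (fun=> 1%:M), G; split.
- near=> e; have [Gorth _ diagG] : P e (G e) by near: e.
  split => //.
  + by rewrite mulmx1 trmx1 mulmx1 /M !mulmxA.
  + by rewrite /symmetric_mx trmx_conj /M trmx_conj tr_diag_mx.
  + exact: orthogonal_mx1.
- apply/eqO_exP; exists 1 => //; near=> e.
  rewrite mul1r subrr [leLHS]ger0_norm ?sqrtr_ge0 //.
  by apply: le_trans (ler_frobenius_l1norm _) _; rewrite l1norm0.
(* The bound obtained is [K D e], and [e <= sqrt e] for [e <= 1]; the [+ 1] makes the constant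
   positive. *)
- apply/eqO_exP; exists (K * D + 1); first by rewrite ltr_wpDl // mulr_ge0.
  near=> e.
  have e_gt0 : 0 < e by near: e; exact: nbhs_right_gt.
  have e_le1 : e <= 1 by near: e; exact: nbhs_right_le.
  have [_ G_le _] : P e (G e) by near: e.
  have Me_le : l1norm (M e - A) <= D * e by near: e.
  have e_le_sqrt : e <= Num.sqrt e.
    have s_le1 : Num.sqrt e <= 1 by rewrite -sqrtr1 ler_wsqrtr.
    by rewrite -{1}(sqr_sqrtr (ltW e_gt0)) expr2 ler_piMr // sqrtr_ge0.
  rewrite [leLHS]ger0_norm ?sqrtr_ge0 // [X in _ * X]ger0_norm ?sqrtr_ge0 //.
  apply: le_trans (ler_frobenius_l1norm _) _; apply: le_trans G_le _.
  apply: (@le_trans _ _ (K * (D * e))); first by rewrite ler_wpM2l.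
  rewrite mulrA; apply: ler_pM => //; first by rewrite mulr_ge0.
  by rewrite lerDl.
Unshelve. all: by end_near. Qed.
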